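(* If $f\in A_2$, then $$\mathsf{L}_{\mathsf{d}_{\mathcal{C}}}(f)\leq\mathsf{L}^{\lambda}_{\mathcal{T}_{\mathcal{C}}}(f)\leq 2\,\mathsf{L}_{\mathsf{d}_{\mathcal{C}}}(f).$$
   Context: Convention: $\mathbb{N}$ contains $0$. The Cantor space is $\mathcal{C}=\{(x_n)_{n\in\mathbb{N}} : x_n\in\{0,1\} \text{ for all } n\}$ with the metric $\mathsf{d}_{\mathcal{C}}(x,y)=0$ if $x=y$ and $\mathsf{d}_{\mathcal{C}}(x,y)=2^{-\min\{m\in\mathbb{N} : x_m\neq y_m\}}$ otherwise. $C(\mathcal{C})$ is the C*-algebra of continuous functions $\mathcal{C}\to\mathbb{C}$ with pointwise operations, supremum norm $\|\cdot\|_\infty$ and unit $1_{C(\mathcal{C})}$ (the constant function $1$). For $n\in\mathbb{N}$, $\eta_n\in C(\mathcal{C})$ is the coordinate map $\eta_n((z_m)_{m\in\mathbb{N}})=z_n$, and $u_n=2\eta_n-1_{C(\mathcal{C})}$ (so $u_n$ takes values in $\{-1,1\}$). Set $B_0=\emptyset$ and, for $n\geq 1$, $B_n=\{\prod_{j\in F}u_j : \emptyset\neq F\subseteq\{0,\ldots,n-1\}\}$. For $n \in \mathbb{N}$ set $B_n'=\{1_{C(\mathcal{C})}\}\cup B_n$ and $A_n=\operatorname{span}_{\mathbb{C}} B_n'$; in particular $A_2=\operatorname{span}_{\mathbb{C}}\{1_{C(\mathcal{C})},u_0,u_1,u_0u_1\}$. $\lambda$ is the state on $C(\mathcal{C})$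 (unital norm-one continuous linear functional) determined by $\lambda\left(\prod_{j\in F}u_j\right)=0$ for every nonempty finite $F\subset\mathbb{N}$; it is integration against the product of the uniform probability measures on $\{0,1\}$. For $n\in\mathbb{N}$, $E_n:C(\mathcal{C})\to A_n$ is $E_n(f)=\sum_{a\in B_n'}\lambda(fa)\,a$. The two seminorms (with values in $[0,\infty]$) are, for $f\in C(\mathcal{C})$, $$\mathsf{L}_{\mathsf{d}_{\mathcal{C}}}(f)=\sup_{x,y\in\mathcal{C},\,x\neq y}\frac{|f(x)-f(y)|}{\mathsf{d}_{\mathcal{C}}(x,y)},\qquad \mathsf{L}^{\lambda}_{\mathcal{T}_{\mathcal{C}}}(f)=\sup_{n\in\mathbb{N}}\frac{\|f-E_n(f)\|_\infty}{2^{-(n+1)}}.$$ *)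

(* Defs.v *)
From HB Require Import structures.
From mathcomp Require Import all_boot all_order all_algebra finmap.
From mathcomp Require Import all_classical all_reals all_analysis.
From mathcomp Require Import complex.

Set Implicit Arguments.
Unset Strict Implicit.
Unset Printing Implicit Defensive.

Import Order.TTheory GRing.Theory Num.Theory numFieldNormedType.Exports.

Local Open Scope classical_set_scope.
Local Open Scope ring_scope.

(* cantor_space carries the product topology of the discrete spaces bool, which
   is the topology induced by the metric dC below. *)
Section ContinuousFunctions.
Variable K : numFieldType.

Definition continuous_pred : {pred cantor_space -> K} :=
  mem [set f : cantor_space -> K | continuous f].

Lemma continuous_pred_subring : subring_closed continuous_pred.
Proof.
split=> [|f g|f g]; rewrite !inE /=.
- by move=> x; exact: cvg_cst.
- by move=> cf cg x; exact: cvgB (cf x) (cg x).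
- by move=> cf cg x; exact: cvgM (cf x) (cg x).
Qed.

HB.instance Definition _ :=
  GRing.isSubringClosed.Build _ continuous_pred continuous_pred_subring.

Record cfun := CFun {
  cfun_val :> cantor_space -> K;
  cfunP : cfun_val \in continuous_pred }.

HB.instance Definition _ := [isSub for cfun_val].
HB.instance Definition _ := [Choice of cfun by <:].
HB.instance Definition _ := [SubChoice_isSubComNzRing of cfun by <:].

Lemma cfun_scale_subproof (a : K) (f : cfun) :
  (fun x => a * f x) \in continuous_pred.
Proof.
by move: (cfunP f); rewrite !inE /= => cf x; apply: cvgM (cf x); exact: cvg_cst.
Qed.

Definition cfun_scale (a : K) (f : cfun) : cfun := CFun (cfun_scale_subproof a f).

Program Definition cfun_lmod_mixin :=
  @GRing.Zmodule_isLmodule.Build K cfun cfun_scale _ _ _ _.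
Next Obligation. by move=> a b f; apply/val_inj/funext => x /=; rewrite mulrA. Qed.
Next Obligation. by move=> f; apply/val_inj/funext => x /=; rewrite mul1r. Qed.
Next Obligation. by move=> a f g; apply/val_inj/funext => x /=; rewrite mulrDr. Qed.
Next Obligation. by move=> f a b; apply/val_inj/funext => x /=; rewrite mulrDl. Qed.
HB.instance Definition _ := cfun_lmod_mixin.

Lemma cfun_scalerAl (a : K) (f g : cfun) : a *: (f * g) = a *: f * g.
Proof. by apply/val_inj/funext => x /=; rewrite mulrA. Qed.

HB.instance Definition _ := GRing.Lmodule_isLalgebra.Build K cfun cfun_scalerAl.

HB.instance Definition _ := GRing.Lalgebra_isComAlgebra.Build K cfun.

Lemma coord_in_continuous_pred (n : nat) :
  (fun z : cantor_space => (z n : nat)%:R : K) \in continuous_pred.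
Proof.
rewrite inE /= => z.
apply: (@continuous_comp _ _ _ (fun z : cantor_space => z n)
  (fun b : bool => (b : nat)%:R : K)); first exact: proj_continuous.
move=> P /nbhs_singleton P0.
by apply: (filterS _ (discrete_set1 (z n))) => b ->; exact: P0.
Qed.

Definition eta (n : nat) : cfun := CFun (coord_in_continuous_pred n).

Definition u_ (n : nat) : cfun := 2 *: eta n - 1.

Definition B_ (n : nat) : set cfun :=
  [set a | exists2 F : {set 'I_n}, F != finset.set0 & a = \prod_(j in F) u_ j].

Definition B'_ (n : nat) : set cfun := [set 1] `|` B_ n.

(* Hence the sum over the elements of B'_ n in E_ below is a genuine finite sum. *)
Lemma finite_B'_ (n : nat) : finite_set (B'_ n).
Proof.
rewrite finite_setU; split; first exact: finite_set1.
apply: (@sub_finite_set _ _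
  ((fun F : {set 'I_n} => \prod_(j in F) u_ j) @` [set: {set 'I_n}])).
  by move=> a [F _ ->]; exists F.
exact: finite_image (@finite_finset _ _).
Qed.

Definition lin_span (V : lmodType K) (S : set V) : set V :=
  [set v | exists (m : nat) (c : 'I_m -> K) (a : 'I_m -> V),
     (forall i, S (a i)) /\ v = \sum_(i < m) c i *: a i].

Definition A_ (n : nat) : set cfun := lin_span (B'_ n).

End ContinuousFunctions.

Arguments eta {K} n.
Arguments u_ {K} n.

Section CantorSeminorms.
Variable R : realType.
Local Notation C := (R[i])%C.
Local Notation CC := (cfun C).
Local Notation modulus := (@Normc.normc R).

Lemma cantor_neq_ex (x y : cantor_space) : x <> y -> exists m, x m != y m.
Proof.
move=> xy; apply: contrapT => /forallNP nxy; apply: xy; apply/funext => m.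
by apply/eqP/negPn/negP; exact: nxy.
Qed.

Definition dC (x y : cantor_space) : R :=
  match pselect (x = y) with
  | left _ => 0
  | right ne => 2 ^- ex_minn (cantor_neq_ex ne)
  end.

(* The supremum norm is finite on CC; it is valued in \bar R so that it can be
   defined as an extended supremum. *)
Definition supnorm (f : CC) : \bar R :=
  ereal_sup (range (fun x : cantor_space => (modulus (f x))%:E)).

Definition opnorm (phi : CC -> C) : \bar R :=
  ereal_sup [set (modulus (phi f))%:E | f in [set f | (supnorm f <= 1)%E]].

Definition is_state (phi : {scalar CC}) : Prop :=
  phi 1 = 1 /\ opnorm phi = 1%E.

(* lambda is only specified on the products of the u_ j; their span together
   with 1 is dense in the continuous functions, so at most one state qualifies. *)
Definition is_lambda (phi : {scalar CC}) : Prop :=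
  is_state phi /\
  forall F : {fset nat}, F != fset0 -> phi (\prod_(j <- F) u_ j) = 0.

Definition E_ (lambda : CC -> C) (n : nat) (f : CC) : CC :=
  \sum_(a \in B'_ n) lambda (f * a) *: a.

Definition L_d (f : CC) : \bar R :=
  ereal_sup [set (modulus (f p.1 - f p.2) / dC p.1 p.2)%:E
            | p in [set p : cantor_space * cantor_space | p.1 != p.2]].

Definition L_T (lambda : CC -> C) (f : CC) : \bar R :=
  ereal_sup (range (fun n : nat =>
    (supnorm (f - E_ lambda n f)%R / (2 ^- n.+1)%R%:E)%E)).

End CantorSeminorms.

(* Main.v *)
Require Import Defs.
From HB Require Import structures.
From mathcomp Require Import all_boot all_order all_algebra finmap.
From mathcomp Require Import all_classical all_reals all_analysis.
From mathcomp Require Import complex.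

Import Order.TTheory GRing.Theory Num.Theory numFieldNormedType.Exports.

Local Open Scope classical_set_scope.
Local Open Scope ring_scope.

(* The Walsh functions prod_(j in F) u_j form a group of signs, and lambda
   annihilates all of them but 1, so they are orthonormal for (f, g) |->
   lambda (f g).  Hence E_n keeps the Walsh functions in B'_n and kills the
   others; in particular E_n f depends only on the first n coordinates, and, for
   f in A_m, E_n f x is the average of f over all ways of redrawing the
   coordinates n, ..., m - 1 of x.

   If x and y first differ at n, then f x - f y = g x - g y for g = f - E_n f,
   so |f x - f y| / 2^-n <= 2 ||g|| / 2^-n = ||g|| / 2^-(n+1).  Conversely
   f x - E_n f x is an average of differences f x - f y with y at distance at
   most 2^-n from x, so it is bounded by 2^-n L_d(f). *)

(** * Walsh functions as a group of signs *)

Section Walsh.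
Variable K : numFieldType.
Implicit Types (a : cfun K) (P Q : pred nat) (x y : cantor_space).

(** Taking a predicate on all of [nat], rather than a subset of ['I_n], lets the same [P] be read at
    different lengths; only its values below [n] matter. *)
Definition walsh (n : nat) (P : pred nat) : cfun K := \prod_(j < n | P j) u_ j.

Lemma uE (j : nat) x : (u_ j : cfun K) x = (-1) ^+ ~~ x j.
Proof.
have -> : (u_ j : cfun K) x = 2 * (x j : nat)%:R - 1 by [].
by case: (x j); rewrite ?mulr1 ?mulr0 ?sub0r ?expr1 // mulr2n addrK.
Qed.

Lemma u_sqr (j : nat) : u_ j * u_ j = 1 :> cfun K.
Proof.
apply/val_inj/funext => x.
have -> : \val (u_ j * u_ j : cfun K) x = (u_ j : cfun K) x * (u_ j : cfun K) x by [].
by rewrite uE -expr2 sqrr_sign.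
Qed.

Lemma walsh_val (n : nat) P x :
  walsh n P x = \prod_(j < n | P j) (u_ j : cfun K) x.
Proof. exact: (big_morph (fun f : cfun K => f x)). Qed.

Lemma walsh0 (n : nat) P : (forall j, (j < n)%N -> P j = false) -> walsh n P = 1.
Proof. by move=> P0; apply: big1 => i; rewrite P0. Qed.

Lemma walsh_widen (n m : nat) P : (n <= m)%N ->
  walsh n P = walsh m [pred j | P j && (j < n)%N].
Proof. by move=> nm; rewrite /walsh (big_ord_widen_cond m P (@u_ K)). Qed.

(** Common factors cancel because each [u_ j] squares to 1, which leaves the symmetric
    difference. *)
Lemma walshM (n : nat) P Q :
  walsh n P * walsh n Q = walsh n [pred j | P j (+) Q j].
Proof.
rewrite /walsh big_mkcond [X in _ * X]big_mkcond -big_split /= [RHS]big_mkcond.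
apply: eq_bigr => i _ /=.
by case: (P i); case: (Q i); rewrite ?u_sqr ?mulr1 ?mul1r.
Qed.

Lemma eq_walsh_prefix (n : nat) P x y :
  (forall j, (j < n)%N -> x j = y j) -> walsh n P x = walsh n P y.
Proof. by move=> xy; rewrite !walsh_val; apply: eq_bigr => i _; rewrite !uE xy. Qed.

Lemma walsh_flip (n : nat) P x y (j : nat) : (j < n)%N -> P j ->
    (forall i, y i = (i == j) (+) x i) ->
  walsh n P y = - walsh n P x.
Proof.
move=> jn Pj xy; rewrite !walsh_val.
rewrite (bigD1 (Ordinal jn)) // [in RHS](bigD1 (Ordinal jn)) // -mulNr.
congr (_ * _); first by rewrite !uE xy eqxx signrN.
apply: eq_bigr => i /andP[_ ij]; rewrite !uE xy.
by rewrite -val_eqE /= in ij; rewrite (negbTE ij).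
Qed.

(** The empty product supplies the unit, so that [1] and the elements of [B_ n] can be treated
    alike. *)
Lemma B'P (n : nat) a : B'_ n a <-> exists P, a = walsh n P.
Proof.
split=> [[->|[F _ ->]]|[P ->]].
- by exists pred0; rewrite walsh0.
- exists [pred k | [exists j in F, val j == k]]; apply: eq_bigl => j /=.
  apply/idP/exists_inP => [jF|[i iF /eqP/val_inj <- //]].
  by exists j.
have [[j Pj]|P0] := pselect (exists j : 'I_n, P j).
  right; exists [set j : 'I_n | P j]%SET.
    by apply/finset.set0Pn; exists j; rewrite inE.
  by apply: eq_bigl => i; rewrite inE.
left; apply: walsh0 => j jn; apply/negP => Pj; apply: P0.
by exists (Ordinal jn).
Qed.

Lemma B'_prefix (n : nat) a x y : B'_ n a ->
  (forall j, (j < n)%N -> x j = y j) -> a x = a y.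
Proof. by move=> /B'P[P ->]; exact: eq_walsh_prefix. Qed.

End Walsh.

(** * Orthonormality and the maps [E_] *)

Section Expectation.
Variable R : realType.
Local Notation C := R[i]%C.
Variable lambda : {scalar cfun C}.
Implicit Types (f : cfun C) (P Q : pred nat) (x y : cantor_space).

Lemma cfun_sumE (I : Type) (r : seq I) (F : I -> cfun C) x :
  (\sum_(i <- r) F i) x = \sum_(i <- r) F i x.
Proof. exact: (big_morph (fun f : cfun C => f x)). Qed.

Lemma cfunZE (c : C) f x : (c *: f) x = c * f x.
Proof. by []. Qed.

Lemma E_seq (n : nat) f :
  E_ lambda n f = \sum_(a <- fset_set (B'_ n)) lambda (f * a) *: a.
Proof. by rewrite /E_ fsbig_finite //; exact: finite_B'_. Qed.

Lemma E_lin (n m : nat) (c : 'I_m -> C) (a : 'I_m -> cfun C) :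
  E_ lambda n (\sum_(i < m) c i *: a i) = \sum_(i < m) c i *: E_ lambda n (a i).
Proof.
rewrite E_seq; under [RHS]eq_bigr do rewrite E_seq scaler_sumr.
rewrite exchange_big /=; apply: eq_bigr => b _.
rewrite mulr_suml linear_sum /= scaler_suml; apply: eq_bigr => i _.
by rewrite -scalerAl linearZ /= scalerA.
Qed.

Lemma E_prefix (n : nat) f x y : (forall j, (j < n)%N -> x j = y j) ->
  E_ lambda n f x = E_ lambda n f y.
Proof.
move=> xy; rewrite E_seq !cfun_sumE !big_seq; apply: eq_bigr => a.
rewrite in_fset_set ?inE; last exact: finite_B'_.
by move=> Ba; rewrite !cfunZE (B'_prefix _ _ _ _ _ Ba xy).
Qed.

Hypothesis hlambda : is_lambda lambda.

Lemma lambda_walsh (n : nat) P (j : nat) : (j < n)%N -> P j ->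
  lambda (walsh C n P) = 0.
Proof.
case: hlambda => _ l0 jn Pj.
pose F := [fset k in [seq k <- iota 0 n | P k]]%fset.
have <- : \prod_(k <- F) u_ k = walsh C n P.
  rewrite /walsh -(big_mkord P (@u_ C)) /index_iota subn0 -[in RHS]big_filter.
  apply: perm_big; apply: uniq_perm; rewrite ?fset_uniq ?filter_uniq ?iota_uniq//.
  by move=> k; rewrite !inE.
apply: l0; apply/fset0Pn; exists j.
by rewrite !inE mem_filter Pj mem_iota.
Qed.

Lemma lambda_orthonormal (n m : nat) (a b : cfun C) : B'_ n a -> B'_ m b ->
  lambda (a * b) = (a == b)%:R.
Proof.
move=> /B'P[P ->] /B'P[Q ->].
(* Both predicates are cut off and carried to the common length [maxn n m], where [walshM]
   applies. *)
rewrite (walsh_widen _ n (maxn n m)) ?leq_maxl // (walsh_widen _ m (maxn n m)) ?leq_maxr //.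
move: (maxn n m) {P Q}[pred j | P j && _] {Q}[pred j | Q j && _] => N P Q.
have [->|PQ] := eqVneq.
  rewrite walshM walsh0; last by move=> j _; exact: addbb.
  by case: hlambda => -[].
rewrite walshM.
have [[j [jN Pj]]|nPQ] := pselect (exists j, (j < N)%N /\ P j (+) Q j).
  by rewrite (lambda_walsh _ _ j).
case/eqP: PQ; apply: eq_bigl => i; apply/eqP.
rewrite -[_ == _]negbK; apply/negP => ne; apply: nPQ; exists i; split => //.
by move: ne; rewrite /=; case: (P i); case: (Q i).
Qed.

(** By orthonormality only the term [a = b] of the defining sum can survive. *)
Lemma E_B' (n m : nat) (b : cfun C) : B'_ m b ->
  E_ lambda n b = if pselect (B'_ n b) then b else 0.
Proof.
move=> Bb; case: pselect => [nb|nb].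
  rewrite /E_ (fsbigD1 b) //=; last exact: finite_B'_.
  rewrite (lambda_orthonormal m m) // eqxx scale1r fsbig1 ?addr0 //.
  move=> a [Ba ab]; rewrite (lambda_orthonormal m n) //.
  by case: eqVneq ab => [->|_ _]; [case | rewrite scale0r].
apply: fsbig1 => a Ba; rewrite (lambda_orthonormal m n) //.
by case: eqVneq => [ba|_]; [rewrite ba in nb | rewrite scale0r].
Qed.

End Expectation.

(** * Averages over redrawn coordinates *)

Section Mean.
Variable R : realType.
Local Notation C := R[i]%C.
Local Notation modulus := (@Normc.normc R).
Implicit Types (f : cfun C) (P : pred nat) (x y : cantor_space).

(** The entries of [z] below [n] are ignored. Each outcome is then counted equally often, so
    averages over all [2 ^ m] choices of [z] are unaffected, and [n] and [m] need not be
    compared. *)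
Definition resample (n m : nat) x (z : {ffun 'I_m -> bool}) : cantor_space :=
  fun k => if (k < n)%N then x k else if insub k is Some i then z i else x k.

Lemma resample_prefix (n m : nat) x (z : {ffun 'I_m -> bool}) (j : nat) :
  (j < n)%N -> x j = resample n m x z j.
Proof. by rewrite /resample => ->. Qed.

Lemma resample_flip (n m : nat) x (z : {ffun 'I_m -> bool}) (j : 'I_m) (k : nat) :
  (n <= j)%N ->
  resample n m x [ffun i => (i == j) (+) z i] k = (k == j) (+) resample n m x z k.
Proof.
move=> nj; rewrite /resample; case: ltnP => [kn|nk].
  by rewrite (ltn_eqF (leq_trans kn nj)).
case: insubP => [i _ <-|]; first by rewrite ffunE.
by case: eqVneq => [->|//]; rewrite ltn_ord.
Qed.

Lemma sum_resample_walsh (n m : nat) P x (j : 'I_m) : (n <= j)%N -> P j ->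
  \sum_(z : {ffun 'I_m -> bool}) walsh C m P (resample n m x z) = 0.
Proof.
(* Flipping the j-th redrawn coordinate permutes the terms and changes their sign. *)
move=> nj Pj; apply/eqP; rewrite -eqNr -sumrN; apply/eqP.
have flipK : involutive (fun z : {ffun 'I_m -> bool} => [ffun i => (i == j) (+) z i]).
  by move=> z; apply/ffunP => i; rewrite !ffunE addbA addbb.
rewrite [RHS](reindex_inj (inv_inj flipK)); apply: eq_bigr => z _.
rewrite [in RHS](walsh_flip _ m P (resample n m x z) _ j) //.
by move=> k; exact: resample_flip.
Qed.

Lemma walsh_B' (n m : nat) P : (forall j, (j < m)%N -> P j -> (j < n)%N) ->
  B'_ n (walsh C m P).
Proof.
move=> Pn; apply/B'P; case: (leqP m n) => [mn|/ltnW nm].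
  by exists [pred j | P j && (j < m)%N]; exact: walsh_widen.
exists P; rewrite (walsh_widen _ n m) //; apply: eq_bigl => j /=.
by case Pj: (P j) => //=; rewrite (Pn j).
Qed.

Lemma E_mean (lambda : {scalar cfun C}) (n m : nat) f x :
  is_lambda lambda -> A_ m f ->
  E_ lambda n f x = 2 ^- m * \sum_(z : {ffun 'I_m -> bool}) f (resample n m x z).
Proof.
move=> hl [k [c [a [Ba ->]]]]; rewrite E_lin cfun_sumE.
under [in RHS]eq_bigr do rewrite cfun_sumE.
rewrite exchange_big mulr_sumr; apply: eq_bigr => i _.
under [in RHS]eq_bigr do rewrite cfunZE.
rewrite -mulr_sumr mulrCA cfunZE; congr (_ * _).
rewrite (E_B' _ _ hl n m) //; case: pselect => [nb|nb].
  (* Here [a i] depends only on the first [n] coordinates: the mean is over [2 ^ m] equal values. *)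
  under eq_bigr => z _ do rewrite -(B'_prefix _ _ _ _ _ nb (resample_prefix n m x z)).
  rewrite sumr_const card_ffun card_bool card_ord -[X in _ * X]mulr_natl natrX.
  by rewrite mulKf // expf_neq0 // pnatr_eq0.
have /B'P[P aP] := Ba i; rewrite aP in nb *.
(* A Walsh function outside [B'_ n] has a factor [u_ j] with [n <= j < m], so its mean vanishes. *)
have [[j [nj Pj]]|nP] := pselect (exists j : 'I_m, (n <= j)%N /\ P j).
  by rewrite (sum_resample_walsh n m P x j) // mulr0.
case: nb; apply: walsh_B' => j jm Pj; rewrite ltnNge; apply/negP => nj.
by apply: nP; exists (Ordinal jm).
Qed.

(** * Moduli, distances and bounds by the seminorms *)

Lemma modulus_ge0 (z : C) : 0 <= modulus z.
Proof. by case: z => a b; exact: sqrtr_ge0. Qed.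

Lemma modulus_pow2 (n : nat) : modulus (2 ^+ n) = 2 ^+ n.
Proof. by rewrite -!natrX normcMn Normc.normc1. Qed.

Lemma modulus_sum (I : finType) (F : I -> C) :
  modulus (\sum_i F i) <= \sum_i modulus (F i).
Proof.
elim/big_ind2: _ => [|z r w s zr ws|//]; first by rewrite Normc.normc0.
exact: le_trans (le_normcD _ _) (lerD zr ws).
Qed.

Lemma dC_first_diff x y : x != y -> exists n : nat,
  [/\ (forall j, (j < n)%N -> x j = y j), x n != y n & dC R x y = 2 ^- n].
Proof.
move=> /eqP xy; rewrite /dC; case: pselect => // ne.
case: ex_minnP => n xyn nmin; exists n; split=> // j jn.
by apply/eqP; apply: contraTT jn => /nmin; rewrite -leqNgt.
Qed.

Lemma L_d_ge0 f : (0 <= L_d f)%E.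
Proof.
pose x : cantor_space := fun=> false; pose y : cantor_space := fun=> true.
have xy : x != y by apply/eqP => /(congr1 (fun x : cantor_space => x 0%N)).
apply: (@le_trans _ _ (modulus (f x - f y) / dC R x y)%:E).
  have [n [_ _ ->]] := dC_first_diff _ _ xy.
  by rewrite lee_fin mulr_ge0 ?modulus_ge0 // invrK exprn_ge0.
by apply: ereal_sup_ubound; exists (x, y).
Qed.

(** Agreement below [n] means distance at most [2 ^- n]. Equal points are allowed because a redraw
    may return [x] itself. *)
Lemma L_d_prefix (n : nat) f x y : (forall j, (j < n)%N -> x j = y j) ->
  ((modulus (f x - f y) * 2 ^+ n)%:E <= L_d f)%E.
Proof.
move=> xyn; have [<-|xy] := eqVneq x y.
  by rewrite subrr Normc.normc0 mul0r; exact: L_d_ge0.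
apply: (@le_trans _ _ (modulus (f x - f y) / dC R x y)%:E); last first.
  by apply: ereal_sup_ubound; exists (x, y).
have [k [_ xyk ->]] := dC_first_diff _ _ xy.
rewrite lee_fin invrK ler_wpM2l ?modulus_ge0 // ler_weXn2l ?ler1n //.
by rewrite leqNgt; apply: contra xyk => /xyn ->.
Qed.

Lemma L_T_ge (lambda : cfun C -> C) (n : nat) f x :
  ((modulus (f x - E_ lambda n f x) * 2 ^+ n.+1)%:E <= L_T lambda f)%E.
Proof.
apply: le_ereal_sup_tmp; exists (supnorm (f - E_ lambda n f)%R / (2 ^- n.+1)%R%:E)%E.
  by exists n.
(* The divisor [2 ^- n.+1] is nonzero, so the extended division is multiplication by [2 ^+ n.+1]. *)
rewrite inver invr_eq0 expf_eq0 pnatr_eq0 andbF invrK EFinM lee_wpmul2r ?lee_fin ?exprn_ge0 //.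
by apply: ereal_sup_ubound; exists x.
Qed.

(** * The two inequalities *)

Lemma L_d_le_L_T (lambda : {scalar cfun C}) f : (L_d f <= L_T lambda f)%E.
Proof.
apply: ge_ereal_sup => _ [[x y] /= xy <-].
have [n [xyn _ ->]] := dC_first_diff _ _ xy.
rewrite invrK.
have -> : f x - f y = (f x - E_ lambda n f x) - (f y - E_ lambda n f y).
  by rewrite (E_prefix _ _ n f _ _ xyn) opprB addrA subrK.
have := L_T_ge lambda n f x; have := L_T_ge lambda n f y.
set p := f x - _; set q := f y - _ => Lq Lp.
(* The sum of the two moduli is at most twice their maximum; this 2 turns [2 ^+ n] into
   [2 ^+ n.+1]. *)
apply: (@le_trans _ _ ((Num.max (modulus p) (modulus q)) * 2 ^+ n.+1)%:E); last first.
  by rewrite maxEle; case: ifP.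
rewrite lee_fin exprS mulrA ler_wpM2r ?exprn_ge0 // mulr_natr mulr2n.
rewrite (le_trans (le_normcD _ _)) // normcN lerD // le_max lexx ?orbT //.
Qed.

Lemma L_T_le_L_d (lambda : {scalar cfun C}) (m : nat) f :
  is_lambda lambda -> A_ m f -> (L_T lambda f <= 2%:E * L_d f)%E.
Proof.
move=> hl fm; apply: ge_ereal_sup => _ [n _ <-].
rewrite inver invr_eq0 expf_eq0 pnatr_eq0 andbF invrK.
rewrite -[(2 ^+ n.+1)%R]invrK lee_pdivrMr ?invr_gt0 ?exprn_gt0 //.
apply: ge_ereal_sup => _ [x _ <-].
(* Nonnegativity excludes [-oo], and for [+oo] the bound is trivial. *)
case: (L_d f) (L_d_ge0 f) (L_d_prefix n f) => [M M0 fM|_ _|//]; last first.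
  by rewrite gt0_muley ?lte_fin // gt0_mulye ?lte_fin ?invr_gt0 ?exprn_gt0 // leey.
rewrite -!EFinM lee_fin.
(* The factor 2 of the claim absorbs the shift in the exponent [n.+1]. *)
have -> : 2 * M * 2 ^- n.+1 = M * 2 ^- n.
  by rewrite exprS invfM (mulrC 2) -mulrA mulVKf // pnatr_eq0.
(* [f x] is the mean of [2 ^ m] copies of itself, so the two means are subtracted termwise. *)
have -> : (f - E_ lambda n f) x =
    2 ^- m * \sum_(z : {ffun 'I_m -> bool}) (f x - f (resample n m x z)).
  rewrite sumrB mulrBr -(E_mean lambda n m f x hl fm) sumr_const card_ffun card_bool card_ord.
  by rewrite -[X in _ * X]mulr_natl natrX mulKf // expf_neq0 // pnatr_eq0.
rewrite Normc.normcM Normc.normcV modulus_pow2 ler_pdivrMl ?exprn_gt0 //.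
apply: le_trans (modulus_sum _ _) _.
apply: (@le_trans _ _ (\sum_(z : {ffun 'I_m -> bool}) M * 2 ^- n)).
  apply: ler_sum => z _; rewrite ler_pdivlMr ?exprn_gt0 // -lee_fin.
  by apply: fM => j; exact: resample_prefix.
by rewrite sumr_const card_ffun card_bool card_ord -[leLHS]mulr_natl natrX.
Qed.
End Mean.

Theorem theorem3p6 (R : realType) (lambda : {scalar cfun R[i]%C})
    (hlambda : is_lambda lambda) (f : cfun R[i]%C) (hf : A_ 2 f) :
  (L_d f <= L_T lambda f)%E /\ (L_T lambda f <= 2%:E * L_d f)%E.
Proof. by split; [exact: L_d_le_L_T | exact: (L_T_le_L_d _ _ 2)]. Qed.
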